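(* In the multi-period newsvendor setting described in the context, suppose the demands $X_1,\dots,X_T$ are independent with $X_t\sim\mathcal N(\mu_t,\sigma_t^2)$, $\sigma_t>0$, and write $\boldsymbol\omega=(\boldsymbol\mu,\boldsymbol\sigma)$. Then, for every fixed $\boldsymbol q$, the expected cost $C_{\boldsymbol\omega}(\boldsymbol q)$ is (1) convex in $\mu_t$ for every $t\in\{1,\dots,T\}$, and (2) increasing in $\sigma_t$ for every $t\in\{1,\dots,T\}$.
   Context: There are $T$ periods; $q_t$ is the order delivered at the start of period $t$, $X_t$ the demand in period $t$. Inventory: $I_t=\sum_{k=1}^t(q_k-X_k)$, $I_t^+=\max\{I_t,0\}$, $I_t^-=\max\{-I_t,0\}$. Nonnegative constants: holding cost $h$, backorder cost $b$, price $p$; unit ordering costs $w_t$. The expected cost under parameters $\boldsymbol\omega$ is $$C_{\boldsymbol\omega}(\boldsymbol q)=p\,\mathbb E_{\boldsymbol\omega}[I_T^-]+\sum_{t=1}^T\Big(h\,\mathbb E_{\boldsymbol\omega}[I_t^+]+b\,\mathbb E_{\boldsymbol\omega}[I_t^-]+w_tq_t-p\,\mathbb E_{\boldsymbol\omega}[X_t]\Big).$$ *)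

(* Defs.v *)
From HB Require Import structures.
From mathcomp Require Import all_boot all_order all_algebra.
From mathcomp Require Import all_classical all_reals all_analysis.
Set Implicit Arguments. Unset Strict Implicit. Unset Printing Implicit Defensive.
Import Order.TTheory GRing.Theory Num.Theory.
Local Open Scope ring_scope.

(* Periods 1..T are represented by indices 0..T-1; a demand / order /
   parameter sequence is a function nat -> R (only indices < T matter). *)

Definition upd {R : realType} (x : nat -> R) (n : nat) (y : R) : nat -> R :=
  fun k => if k == n then y else x k.

(* Expectation of f(X_0,...,X_{n-1}) when X_0,...,X_{n-1} are independent
   with X_k ~ N(m k, (s k)^2): the integral against the product of the
   normal laws, written as an iterated (Fubini) integral.  Coordinates
   >= n are set to 0 and never used below. *)
Fixpoint iexp {R : realType} (n : nat) (m s : nat -> R)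
    (f : (nat -> R) -> \bar R) : \bar R :=
  match n with
  | 0 => f (fun _ => 0)
  | n'.+1 => (\int[normal_prob (m n') (s n')]_y
                 iexp n' m s (fun x => f (upd x n' y)))%E
  end.

(* inventory at the end of period t (1-based): I_t = sum_{k<=t} (q_k - X_k) *)
Definition Inv {R : realType} (q x : nat -> R) (t : nat) : R :=
  \sum_(k < t) (q k - x k).

Definition pos {R : realType} (a : R) : R := Num.max a 0.
Definition neg {R : realType} (a : R) : R := Num.max (- a) 0.

Definition cost {R : realType} (T : nat) (h b p : R) (w q : nat -> R)
    (mu sigma : nat -> R) : \bar R :=
  let E := iexp T mu sigma in
  ((p%:E * E (fun x => (neg (Inv q x T))%:E)) +
   \sum_(t < T)
     (h%:E * E (fun x => (pos (Inv q x t.+1))%:E)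
      + b%:E * E (fun x => (neg (Inv q x t.+1))%:E)
      + (w t * q t)%:E
      - p%:E * E (fun x => (x t)%:E)))%E.

(* Main.v *)
Require Import Defs.
From HB Require Import structures.
From mathcomp Require Import all_boot all_order all_algebra.
From mathcomp Require Import all_classical all_reals all_analysis.
From mathcomp Require Import measurable_realfun.
From mathcomp Require Import ring lra.
Import Order.TTheory GRing.Theory Num.Theory.
Local Open Scope ring_scope.

(* The law of [c - X_0 - ... - X_(t-1)] is obtained by smoothing with one
   Gaussian after the other, and each smoothing operator is linear, monotone and
   preserves Lipschitz convex functions. Smoothing with N(m, s^2) is smoothing
   with N(0, s^2) followed by a translation by m, so for a convex function it is
   convex in m. It is nondecreasing in s because a centred Gaussian is symmetric.
   Since the positive and negative parts are convex and E[X_t] = mu_t is affine,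
   both claims pass from the smoothing at period t to every later period. *)

(** * Every normal law as an affine image of the standard one *)

Definition affine {R : realType} (m s : R) (z : measurableTypeR R) :
  measurableTypeR R := m + s * z.

Lemma measurable_affine {R : realType} (m s : R) :
  measurable_fun setT (affine m s).
Proof. by apply: measurable_funD => //; exact: measurable_funM. Qed.

(** The factor [|s|] undoes the scaling by [1 / |s|] under the image, so that for [s != 0] this is
    Lebesgue measure again. *)
Definition affine_lebesgue {R : realType} (m s : R) :
    {measure set (measurableTypeR R) -> \bar R} :=
  mscale (NngNum (normr_ge0 s))
    (measure_function_pushforward__canonical__measure_function_Measure
      lebesgue_measure (measurable_affine m s)).

Lemma lebesgue_measure_affine {R : realType} (m s : R) (A : set R) :
  s != 0 -> measurable A -> lebesgue_measure A = affine_lebesgue m s A.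
Proof.
move=> s0 mA; apply: lebesgue_measure_unique => // X.
move=> /ocitvP[->|[[a b] /= ab ->]]; first by rewrite !measure0.
rewrite lebesgue_measure_itv/= lte_fin ab /affine_lebesgue /mscale/= /pushforward.
have := s0; rewrite neq_lt => /orP[s_lt0|s_gt0].
  (* A negative slope reverses the interval, so the closed end moves to the left. *)
  have -> : (affine m s @^-1` `]a, b] = `[(b - m) / s, (a - m) / s[)%classic.
    apply/seteqP; split => z /=; rewrite !in_itv /= ler_ndivrMr// ltr_ndivlMr//;
      rewrite /affine => /andP[? ?]; apply/andP; split; lra.
  rewrite lebesgue_measure_itv/= lte_fin ltr_ndivrMr// divfK// ltrD2r ab.
  by rewrite -EFinD -EFinM ltr0_norm//; congr EFin; field.
have -> : (affine m s @^-1` `]a, b] = `](a - m) / s, (b - m) / s])%classic.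
  apply/seteqP; split => z /=; rewrite !in_itv /= ler_pdivlMr// ltr_pdivrMr//;
    rewrite /affine => /andP[? ?]; apply/andP; split; lra.
rewrite lebesgue_measure_itv/= lte_fin ltr_pdivrMr// divfK// ltrD2r ab.
by rewrite -EFinD -EFinM gtr0_norm//; congr EFin; field.
Qed.

Lemma normal_pdf_affine {R : realType} (m s z : R) : s != 0 ->
  `|s| * normal_pdf m s (m + s * z) = normal_pdf 0 1 z.
Proof.
move=> s0; rewrite !normal_pdfE ?oner_eq0// mulrA /normal_fun.
have -> : - (m + s * z - m) ^+ 2 / (s ^+ 2 *+ 2) = - (z - 0) ^+ 2 / (1 ^+ 2 *+ 2).
  by field.
congr (_ * _); rewrite /normal_peak expr1n mul1r -[s ^+ 2 * _ *+ 2]mulrnAr.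
by rewrite sqrtrM ?sqr_ge0// sqrtr_sqr invfM mulrA divff ?normr_eq0// mul1r.
Qed.

(** Substituting [m + s * z] in the density produces the factor [|s|], which [normal_pdf_affine]
    absorbs. Negative [s] is allowed: the reflection [s = - 1] later gives symmetry. *)
Lemma normal_prob_affine {R : realType} (m s : R) (A : set R) :
  s != 0 -> measurable A ->
  normal_prob m s A = pushforward (normal_prob 0 1) (affine m s) A.
Proof.
move=> s0 mA; rewrite /pushforward /normal_prob.
have mphi := measurable_affine m s.
have mA' : measurable (affine m s @^-1` A)%classic.
  by rewrite -[X in measurable X]setTI; exact: mphi.
have mpdf := measurable_normal_pdf m s.
have pdf0 x : (0 <= (normal_pdf m s x)%:E)%E by rewrite lee_fin normal_pdf_ge0.
rewrite (eq_measure_integral (affine_lebesgue m s)); last first.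
  by move=> B mB _; exact: lebesgue_measure_affine.
rewrite ge0_integral_mscale//; last first.
  by apply/measurable_EFinP; exact: measurable_funTS.
rewrite ge0_integral_pushforward//; last first.
  by apply/measurable_EFinP; exact: measurable_funTS.
rewrite -ge0_integralZl//=.
- apply: eq_integral => z _ /=.
  by rewrite -EFinM /affine normal_pdf_affine.
- by apply/measurable_EFinP/measurable_funTS; exact: measurableT_comp.
Qed.

(** * Integration against normal laws and the first absolute moment *)

Lemma ge0_integral_normal_prob {R : realType} (m s : R) (f : R -> \bar R) :
  (forall x, (0 <= f x)%E) -> measurable_fun setT f ->
  (\int[normal_prob m s]_x f x =
   \int[lebesgue_measure]_x (f x * (normal_pdf m s x)%:E))%E.
Proof.
move=> f0 mf; have dom := @normal_prob_dominates R m s.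
rewrite -(Radon_Nikodym_SigmaFinite.change_of_variables dom)//.
have mpdf : measurable_fun setT (fun x => (normal_pdf m s x)%:E).
  by apply/measurable_EFinP; exact: measurable_normal_pdf.
have iRN := Radon_Nikodym_SigmaFinite.f_integrable dom.
apply: ae_eq_integral => //.
- by apply: emeasurable_funM => //; exact: measurable_int iRN.
- exact: emeasurable_funM.
(* The Radon-Nikodym derivative and the density have equal integrals over every measurable set,
   hence agree almost everywhere. *)
- apply: ae_eqe_mul2l; apply: integral_ae_eq => //.
  by move=> E _ mE; rewrite -Radon_Nikodym_SigmaFinite.f_integral.
Qed.

(** The function [|x|] times the standard density is bounded by a multiple of the density of
    standard deviation 2, whose integral is 1. *)
Lemma integrable_id_normal_prob01 {R : realType} :
  (normal_prob 0 1).-integrable [set: R] (EFin \o id).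
Proof.
apply/integrableP; split; first exact/measurable_EFinP.
have mnorm : measurable_fun [set: R] (fun x => `|x|%:E).
  by apply/measurable_EFinP; exact: normr_measurable.
have mpdf s : measurable_fun [set: R] (fun x => (normal_pdf 0 s x)%:E).
  by apply/measurable_EFinP; exact: measurable_normal_pdf.
rewrite (ge0_integral_normal_prob _ _ (fun x => `|x|%:E))//.
(* The ratio exchanges the normalizing constants, leaving only exponentials to compare. *)
pose c : R := normal_peak 1 / normal_peak 2.
have c0 : 0 <= c by rewrite divr_ge0 ?normal_peak_ge0.
apply: (@le_lt_trans _ _
    (\int[lebesgue_measure]_x (c%:E * (normal_pdf 0 2 x)%:E))%E); last first.
  rewrite ge0_integralZl//=; last 2 first.
  - exact: mpdf.
  - by move=> x _; rewrite lee_fin normal_pdf_ge0.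
  by rewrite integral_normal_pdf mule1 ltry.
apply: ge0_le_integral => //.
- by move=> x _; rewrite mule_ge0// lee_fin normal_pdf_ge0.
- by apply: emeasurable_funM; [exact: mnorm|exact: mpdf].
- by apply: emeasurable_funM => //; exact: mpdf.
move=> x _ /=; rewrite -!EFinM lee_fin !normal_pdfE ?oner_eq0// /c.
have p2 : normal_peak (2 : R) != 0 by rewrite gt_eqF// normal_peak_gt0.
rewrite [leRHS]mulrA divfK// mulrCA; apply: ler_wpM2l; first exact: normal_peak_ge0.
(* [|x| <= 1 + 3 x^2 / 8 <= exp (3 x^2 / 8)], and [3/8 = 1/2 - 1/8] *)
have : `|x| <= expR (3 / 8 * x ^+ 2).
  apply: le_trans (expR_ge1Dx _).
  (* Completing the square: [3/8 * (|x| - 4/3)^2 = 3/8 * x^2 - |x| + 2/3]. *)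
  by have := sqr_ge0 (`|x| - 4 / 3); rewrite -(real_normK (num_real x)); lra.
move=> /(ler_wpM2r (normal_fun_ge0 0 1 x))/le_trans; apply.
rewrite /normal_fun -expRD ler_expR.
by rewrite le_eqVlt; apply/orP; left; apply/eqP; field.
Qed.

Lemma integral_normal_prob_affine {R : realType} (m s : R) (f : R -> \bar R) :
  s != 0 -> measurable_fun setT f ->
  (normal_prob 0 1).-integrable setT (f \o affine m s) ->
  (\int[normal_prob m s]_x f x =
   \int[normal_prob 0 1]_z f (affine m s z))%E.
Proof.
move=> s0 mf intf; have mphi := measurable_affine m s.
transitivity (\int[pushforward (normal_prob 0 1) (affine m s)]_y f y)%E.
  by apply: eq_measure_integral => A mA _; exact: normal_prob_affine.
exact: integral_pushforward.
Qed.

(** * Lipschitz functions and their integrability *)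

Definition lip {R : realType} (G : R -> R) : Prop :=
  exists2 k, 0 < k & forall x y, `|G x - G y| <= k * `|x - y|.

Definition convex {R : realType} (G : R -> R) : Prop :=
  forall l x y, 0 <= l <= 1 -> G (l * x + (1 - l) * y) <= l * G x + (1 - l) * G y.

Lemma measurable_lip {R : realType} (G : R -> R) : lip G -> measurable_fun setT G.
Proof.
move=> [k k0 Gk]; apply: continuous_measurable_fun => x.
apply/cvgrPdist_lt => e e0; near=> y.
apply: le_lt_trans (Gk x y) _; rewrite mulrC -ltr_pdivlMr//.
by near: y; apply: cvgr_dist_lt; [exact: cvg_id|exact: divr_gt0].
Unshelve. all: end_near. Qed.

Lemma lip_affine {R : realType} (G : R -> R) (c m s : R) :
  lip G -> lip (fun z => G (c - (m + s * z))).
Proof.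
(* The added 1 keeps the constant positive, as [lip] demands, even when [s = 0]. *)
move=> [k k0 Gk]; exists (k * (`|s| + 1)).
  by rewrite mulr_gt0// ltr_wpDl.
move=> x y; apply: le_trans (Gk _ _) _.
have -> : c - (m + s * x) - (c - (m + s * y)) = s * (y - x) by ring.
rewrite normrM (distrC y) -mulrA; apply: ler_wpM2l; first exact: ltW.
by apply: ler_wpM2r; rewrite // lerDl.
Qed.

(** Growth is at most linear, [|G z| <= |G 0| + k * |z|], and the first absolute moment is
    finite. *)
Lemma integrable_lip {R : realType} (G : R -> R) : lip G ->
  (normal_prob 0 1).-integrable [set: R] (EFin \o G).
Proof.
move=> lG; have mG := measurable_lip _ lG; case: lG => k k0 Gk.
refine (@le_integrable _ (measurableTypeR R) _ _ _ _ _
  (EFin \o (fun z => `|G 0| + k * `|z|)) _ _ _) => //.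
- exact/measurable_EFinP.
- move=> x _ /=; rewrite lee_fin [leRHS]ger0_norm ?addr_ge0 ?mulr_ge0 ?(ltW k0)//.
  have := Gk x 0; rewrite subr0 => H.
  by have := ler_normD (G 0) (G x - G 0); rewrite addrC subrK; lra.
- refine (@integrableD _ (measurableTypeR R) _ _ _ _
    (EFin \o cst `|G 0|) (EFin \o (fun z => k * `|z|)) _ _) => //.
  + exact: finite_measure_integrable_cst.
  + refine (@integrableZl _ (measurableTypeR R) _ _ _ _ k
      (fun z => `|z|%:E) _) => //.
    exact: (integrable_abse integrable_id_normal_prob01).
Qed.

(** * Gaussian symmetry and the smoothing operator *)

Lemma normal_probN {R : realType} (m s : R) : normal_prob m (- s) = normal_prob m s.
Proof.
apply/funext => A; apply: eq_integral => x _; congr EFin.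
by rewrite /normal_pdf /normal_peak /normal_fun oppr_eq0 sqrrN.
Qed.

Lemma Rintegral_normal_prob01N {R : realType} (G : R -> R) : lip G ->
  \int[normal_prob 0 1]_z G z = \int[normal_prob 0 1]_z G (- z).
Proof.
move=> lG; rewrite /Rintegral; congr fine.
have -> : (fun z => (G (- z))%:E) = (fun z => (G (affine 0 (- 1) z))%:E).
  by apply/funext => z; rewrite /affine add0r mulN1r.
(* The left-hand law is read as the one with parameter [- 1], and the affine change of variables
   then reflects [z]. *)
rewrite -[LHS]/(\int[normal_prob 0 1]_z (G z)%:E)%E -{1}normal_probN.
apply: (integral_normal_prob_affine 0 (- 1) (fun z => (G z)%:E)).
- by rewrite oppr_eq0 oner_eq0.
- by apply/measurable_EFinP; exact: measurable_lip.
- have := integrable_lip _ (lip_affine _ 0 0 1 lG); congr (integrable _ _ _).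
  by apply/funext => z; rewrite /= /affine !add0r mul1r mulN1r.
Qed.

(** For [s != 0] this is the expectation of [G (c - Y)] with [Y] normal of parameters [m], [s]. The
    parameters sit in the integrand, so different values are compared under one fixed law. *)
Definition gauss_smooth {R : realType} (G : R -> R) (m s c : R) : R :=
  \int[normal_prob 0 1]_z G (c - (m + s * z)).

Section gauss_smooth.
Context {R : realType}.
Implicit Types (G H : R -> R) (m s c l : R).

Lemma integral_normal_prob_shift G m s c : lip G -> s != 0 ->
  (\int[normal_prob m s]_y (G (c - y))%:E = (gauss_smooth G m s c)%:E)%E.
Proof.
move=> lG s0.
have iG := integrable_lip _ (lip_affine _ c m s lG).
rewrite (integral_normal_prob_affine m s (fun y => (G (c - y))%:E))//.
  by rewrite /gauss_smooth /Rintegral fineK//; exact: integrable_fin_num.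
have := measurable_lip _ (lip_affine _ c 0 1 lG).
move=> mG; apply/measurable_EFinP; move: mG; congr measurable_fun.
by apply/funext => y; rewrite add0r mul1r.
Qed.

Lemma gauss_smooth_shift G m s c : gauss_smooth G m s c = gauss_smooth G 0 s (c - m).
Proof.
by apply: eq_Rintegral => z _; congr G; ring.
Qed.

Lemma le_gauss_smooth G H m s c : lip G -> lip H -> (forall x, G x <= H x) ->
  gauss_smooth G m s c <= gauss_smooth H m s c.
Proof.
by move=> lG lH GH; apply: le_Rintegral => //; apply: integrable_lip; exact: lip_affine.
Qed.

(** All three smoothings use the same standard normal variable, so a pointwise inequality in [z]
    integrates. This serves convexity in [c] and in [m], and monotonicity in [s]. *)
Lemma le_gauss_smooth_conv F G H m m1 m2 s s1 s2 c c1 c2 l : lip F -> lip G -> lip H ->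
  (forall z, F (c - (m + s * z)) <=
    l * G (c1 - (m1 + s1 * z)) + (1 - l) * H (c2 - (m2 + s2 * z))) ->
  gauss_smooth F m s c <=
    l * gauss_smooth G m1 s1 c1 + (1 - l) * gauss_smooth H m2 s2 c2.
Proof.
move=> lF lG lH FGH.
have iF := integrable_lip _ (lip_affine _ c m s lF).
have iG := integrable_lip _ (lip_affine _ c1 m1 s1 lG).
have iH := integrable_lip _ (lip_affine _ c2 m2 s2 lH).
have ilG := integrableZl measurableT l iG.
have ilH := integrableZl measurableT (1 - l) iH.
rewrite /gauss_smooth -!RintegralZl// -RintegralD//.
apply: le_Rintegral => //.
exact: (integrableD measurableT ilG ilH).
Qed.

Lemma lip_gauss_smooth G m s : lip G -> lip (gauss_smooth G m s).
Proof.
move=> lG; have [k k0 Gk] := lG; exists k => // x y.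
have iG c := integrable_lip _ (lip_affine _ c m s lG).
rewrite /gauss_smooth -RintegralB//.
apply: le_trans (le_normr_Rintegral _ _) _ => //.
  exact: (integrableB measurableT (iG x) (iG y)).
apply: (@le_trans _ _ (\int[normal_prob 0 1]_z (k * `|x - y|))); last first.
  rewrite Rintegral_cst// [X in fine X](_ : _ = 1%E) ?mulr1//.
  exact: probability_setT.
apply: le_Rintegral => //.
- exact: (integrable_norm (integrableB measurableT (iG x) (iG y))).
- exact: finite_measure_integrable_cst.
- move=> z _; apply: le_trans (Gk _ _) _.
  by rewrite (_ : _ - _ - _ = x - y)//; ring.
Qed.

Lemma convex_gauss_smooth G m s : lip G -> convex G -> convex (gauss_smooth G m s).
Proof.
move=> lG cG l x y l01; apply: le_gauss_smooth_conv => // z.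
apply: le_trans (cG l _ _ l01); rewrite le_eqVlt; apply/orP; left; apply/eqP; congr G; ring.
Qed.

Lemma gauss_smooth_convex_mean G s c l m1 m2 : lip G -> convex G -> 0 <= l <= 1 ->
  gauss_smooth G (l * m1 + (1 - l) * m2) s c <=
  l * gauss_smooth G m1 s c + (1 - l) * gauss_smooth G m2 s c.
Proof.
move=> lG cG l01; apply: le_gauss_smooth_conv => // z.
apply: le_trans (cG l _ _ l01).
by rewrite le_eqVlt; apply/orP; left; apply/eqP; congr G; ring.
Qed.

Lemma gauss_smoothN G m s c : lip G -> gauss_smooth G m (- s) c = gauss_smooth G m s c.
Proof.
move=> lG; rewrite /gauss_smooth.
rewrite (Rintegral_normal_prob01N _ (lip_affine _ c m (- s) lG)).
by apply: eq_Rintegral => z _; rewrite mulrNN.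
Qed.

(* [s1 z] is a convex combination of [s2 z] and [- s2 z], which have the same
   law. *)
Lemma gauss_smooth_le_sd G m c s1 s2 : lip G -> convex G -> 0 < s1 -> s1 <= s2 ->
  gauss_smooth G m s1 c <= gauss_smooth G m s2 c.
Proof.
move=> lG cG s10 s12; have s20 : 0 < s2 := lt_le_trans s10 s12.
(* The weight solves [l * s2 + (1 - l) * (- s2) = s1]. *)
pose l := (1 + s1 / s2) / 2.
have l01 : 0 <= l <= 1.
  have a0 : 0 <= s1 / s2 by rewrite divr_ge0// ltW.
  have a1 : s1 / s2 <= 1 by rewrite ler_pdivrMr// mul1r.
  by rewrite /l; apply/andP; split; lra.
have -> : gauss_smooth G m s2 c =
    l * gauss_smooth G m s2 c + (1 - l) * gauss_smooth G m (- s2) c.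
  by rewrite gauss_smoothN//; ring.
apply: le_gauss_smooth_conv => // z; apply: le_trans (cG l _ _ l01).
rewrite le_eqVlt; apply/orP; left; apply/eqP; congr G; rewrite /l; field.
by rewrite gt_eqF.
Qed.

Lemma gauss_smooth_opp m s c : gauss_smooth (@GRing.opp R) m s c = m - c.
Proof.
have iz := @integrable_id_normal_prob01 R.
have z0 : \int[normal_prob 0 1]_z (z : R) = 0.
  have lid : lip (id : R -> R) by exists 1 => // x y; rewrite mul1r.
  (* By symmetry the mean of the standard normal equals its own opposite, hence vanishes. *)
  have := Rintegral_normal_prob01N _ lid.
  under [X in _ = X -> _]eq_Rintegral do rewrite -mulN1r.
  by rewrite RintegralZl//; lra.
have iszc := integrableZl measurableT s iz.
have ic : (normal_prob 0 1).-integrable [set: R] (EFin \o cst (m - c)).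
  exact: finite_measure_integrable_cst.
transitivity (\int[normal_prob 0 1]_z (m - c + s * z)).
  by apply: eq_Rintegral => z _; ring.
rewrite RintegralD// Rintegral_cst// RintegralZl// z0 mulr0 addr0.
by rewrite [X in fine X](_ : _ = 1%E) ?mulr1//; exact: probability_setT.
Qed.

End gauss_smooth.

(** * Smoothing over successive periods and its link with the iterated expectation *)

Fixpoint iter_smooth {R : realType} (n : nat) (m s : nat -> R) (G : R -> R) : R -> R :=
  if n is n'.+1 then gauss_smooth (iter_smooth n' m s G) (m n') (s n') else G.

Section iter_smooth.
Context {R : realType}.
Implicit Types (G : R -> R) (m s : nat -> R).

Lemma lip_iter_smooth n m s G : lip G -> lip (iter_smooth n m s G).
Proof. by move=> lG; elim: n => //= n; exact: lip_gauss_smooth. Qed.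

Lemma convex_iter_smooth n m s G : lip G -> convex G -> convex (iter_smooth n m s G).
Proof.
move=> lG cG; elim: n => //= n IHn.
by apply: convex_gauss_smooth => //; exact: lip_iter_smooth.
Qed.

Lemma eq_iter_smooth n m m' s s' G :
  (forall k, (k < n)%N -> m k = m' k /\ s k = s' k) ->
  iter_smooth n m s G = iter_smooth n m' s' G.
Proof.
elim: n => //= n IHn ms; have [-> ->] := ms n (ltnSn n).
by rewrite IHn// => k kn; apply: ms; exact: ltnW.
Qed.

Lemma upd_same (x : nat -> R) t y : upd x t y t = y.
Proof. by rewrite /upd eqxx. Qed.

Lemma upd_neq (x : nat -> R) t y k : k != t -> upd x t y k = x k.
Proof. by rewrite /upd => /negbTE ->. Qed.

Lemma iter_smooth_convex_mean n m s G t l a1 a2 c : lip G -> convex G -> 0 <= l <= 1 ->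
  iter_smooth n (upd m t (l * a1 + (1 - l) * a2)) s G c <=
  l * iter_smooth n (upd m t a1) s G c + (1 - l) * iter_smooth n (upd m t a2) s G c.
Proof.
move=> lG cG l01; elim: n c => [|n IHn] c /=; first by rewrite -mulrDl subrKC mul1r.
have lS m' := lip_iter_smooth n m' s G lG.
(* If the outer period is not [t], the induction hypothesis holds pointwise and is integrated. If it
   is [t], the inner smoothing does not see the changed mean, and convexity in the mean of one
   smoothing applies. *)
have [->|nt] := eqVneq n t; last first.
  by rewrite !upd_neq//; apply: le_gauss_smooth_conv.
have updE a : iter_smooth t (upd m t a) s G = iter_smooth t m s G.
  by apply: eq_iter_smooth => k kt; rewrite upd_neq// neq_ltn kt.
rewrite !upd_same !updE; apply: gauss_smooth_convex_mean => //.
  exact: lip_iter_smooth.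
exact: convex_iter_smooth.
Qed.

Lemma iter_smooth_le_sd n m s G t a1 a2 c : lip G -> convex G -> 0 < a1 -> a1 <= a2 ->
  iter_smooth n m (upd s t a1) G c <= iter_smooth n m (upd s t a2) G c.
Proof.
move=> lG cG a10 a12; elim: n c => [|n IHn] c //=.
have lS s' := lip_iter_smooth n m s' G lG.
have [->|nt] := eqVneq n t; last by rewrite !upd_neq//; exact: le_gauss_smooth.
have updE a : iter_smooth t m (upd s t a) G = iter_smooth t m s G.
  by apply: eq_iter_smooth => k kt; rewrite upd_neq// neq_ltn kt.
rewrite !upd_same !updE; apply: gauss_smooth_le_sd => //.
  exact: lip_iter_smooth.
exact: convex_iter_smooth.
Qed.

Lemma integral_normal_prob_cst (mean sd c : R) :
  (\int[normal_prob mean sd]__ c%:E = c%:E)%E.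
Proof.
rewrite integral_cst// [X in (_ * X)%E](_ : _ = 1%E) ?mule1//.
exact: probability_setT.
Qed.

Lemma iexp_cst n m s (c : R) : iexp n m s (fun=> c%:E) = c%:E.
Proof.
elim: n => //= n IHn; rewrite -[RHS](integral_normal_prob_cst (m n) (s n)).
by apply: eq_integral => y _.
Qed.

(** The outermost integral is over the last coordinate: when it occurs in the sum it performs one
    smoothing, otherwise it integrates a constant against a probability. *)
Lemma iexp_sum n t m s G c : lip G -> (forall k, (k < n)%N -> s k != 0) -> (t <= n)%N ->
  iexp n m s (fun x => (G (c - \sum_(k < t) x k))%:E) = (iter_smooth t m s G c)%:E.
Proof.
move=> lG; elim: n t c => [|n IHn] t c s0.
  by rewrite leqn0 => /eqP ->; rewrite /= big_ord0 subr0.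
have {}IHn := IHn _ _ (fun k kn => s0 k (ltnW kn)).
rewrite leq_eqVlt => /orP[/eqP ->|tn] /=.
  rewrite -integral_normal_prob_shift ?s0//; last exact: lip_iter_smooth.
  apply: eq_integral => y _; rewrite -IHn//; congr iexp; apply/funext => x.
  rewrite big_ord_recr/= upd_same; congr (G _)%:E.
  rewrite opprD [- _ - y]addrC addrA; congr (_ - _).
  by apply: eq_bigr => k _; rewrite upd_neq// neq_ltn ltn_ord.
rewrite -[RHS](integral_normal_prob_cst (m n) (s n)).
apply: eq_integral => y _; rewrite -IHn//; congr iexp; apply/funext => x.
congr (G (c - _))%:E; apply: eq_bigr => k _.
by rewrite upd_neq// neq_ltn (leq_trans (ltn_ord k)).
Qed.

Lemma iexp_coord n t m s : (forall k, (k < n)%N -> s k != 0) -> (t < n)%N ->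
  iexp n m s (fun x => (x t)%:E) = (m t)%:E.
Proof.
elim: n => // n IHn s0; rewrite ltnS leq_eqVlt => /orP[/eqP ->|tn] /=.
  (* The coordinate [y] is written as [G (0 - y)] with [G] the negation, so that smoothing computes
     its mean. *)
  have lN : lip (@GRing.opp R).
    by exists 1 => // x y; rewrite mul1r -opprD normrN.
  have := integral_normal_prob_shift _ (m n) _ 0 lN (s0 n (ltnSn n)).
  rewrite gauss_smooth_opp subr0 => <-.
  apply: eq_integral => y _; rewrite sub0r opprK -[RHS](iexp_cst n m s).
  by congr iexp; apply/funext => x; rewrite upd_same.
rewrite -[RHS](integral_normal_prob_cst (m n) (s n)).
apply: eq_integral => y _; rewrite -[RHS]IHn// => [|k kn]; last exact/s0/ltnW.
by congr iexp; apply/funext => x; rewrite upd_neq// neq_ltn tn.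
Qed.

End iter_smooth.

(** * Positive and negative parts, and the cost in terms of smoothings *)

Lemma lip_pos {R : realType} : lip (@pos R).
Proof.
exists 1 => // x y; rewrite mul1r /pos /Num.max.
by case: (ltP x 0); case: (ltP y 0) => *; rewrite ler_norml; apply/andP;
  have := ler_norm (x - y); have := ler_norm (y - x); rewrite (distrC y); split; lra.
Qed.

Lemma convex_pos {R : realType} : convex (@pos R).
Proof.
move=> l x y /andP[l0 l1]; rewrite /pos ge_max; apply/andP; split.
  by apply: lerD; apply: ler_wpM2l; rewrite ?subr_ge0// le_max lexx.
by rewrite addr_ge0// mulr_ge0 ?subr_ge0// le_max lexx orbT.
Qed.

Lemma lip_neg {R : realType} : lip (@neg R).
Proof.
have [k k0 posk] := @lip_pos R; exists k => // x y.
by rewrite (_ : x - y = - (- x - - y)) ?normrN; [exact: posk|ring].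
Qed.

Lemma convex_neg {R : realType} : convex (@neg R).
Proof.
move=> l x y l01; have := convex_pos l (- x) (- y) l01.
by rewrite !mulrN -opprD.
Qed.

(** All expectations are finite, so the extended-real cost is a real number and the inequalities can
    be proved in [R]. *)
Lemma costE {R : realType} (T : nat) (h b p : R) (w q m s : nat -> R) :
  (forall t, (t < T)%N -> s t != 0) ->
  cost T h b p w q m s =
  (p * iter_smooth T m s neg (\sum_(k < T) q k) + \sum_(t < T)
     (h * iter_smooth t.+1 m s pos (\sum_(k < t.+1) q k)
      + b * iter_smooth t.+1 m s neg (\sum_(k < t.+1) q k)
      + w t * q t - p * m t))%:E.
Proof.
move=> s0; have lp := @lip_pos R; have ln := @lip_neg R.
have E (G : R -> R) t : lip G -> (t <= T)%N ->
    iexp T m s (fun x => (G (Defs.Inv q x t))%:E) =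
    (iter_smooth t m s G (\sum_(k < t) q k))%:E.
  move=> lG tT; rewrite -(iexp_sum T)//; congr iexp; apply/funext => x.
  by rewrite /Defs.Inv sumrB.
rewrite /cost E//.
rewrite EFinD EFinM -sumEFin; congr (_ + _)%E; apply: eq_bigr => t _.
by rewrite !E ?iexp_coord.
Qed.

Theorem theorem4p3 (R : realType) (T : nat) (h b p : R) (w q mu sigma : nat -> R) :
  0 <= h -> 0 <= b -> 0 <= p ->
  (forall t, (t < T)%N -> 0 < sigma t) ->
  (* (1) convexity in mu_t *)
  (forall t, (t < T)%N -> forall (a1 a2 l : R), 0 <= l <= 1 ->
     (cost T h b p w q (upd mu t (l * a1 + (1 - l) * a2)) sigma
      <= l%:E * cost T h b p w q (upd mu t a1) sigma
         + (1 - l)%:E * cost T h b p w q (upd mu t a2) sigma)%E)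
  /\
  (* (2) increasing (nondecreasing) in sigma_t on sigma_t > 0 *)
  (forall t, (t < T)%N -> forall (s1 s2 : R), 0 < s1 -> s1 <= s2 ->
     (cost T h b p w q mu (upd sigma t s1)
      <= cost T h b p w q mu (upd sigma t s2))%E).
Proof.
move=> h0 b0 p0 sigma0; have pn := @lip_neg R; have cn := @convex_neg R.
have pp := @lip_pos R; have cp := @convex_pos R; split=> t tT.
  move=> a1 a2 l l01.
  rewrite !costE; try by move=> k kT; rewrite gt_eqF// sigma0.
  rewrite -!EFinM -EFinD lee_fin !mulrDr addrACA; apply: lerD.
    have := ler_wpM2l p0 (iter_smooth_convex_mean T mu sigma neg t l a1 a2
      (\sum_(k < T) q k) pn cn l01).
    by move/le_trans; apply; rewrite le_eqVlt; apply/orP; left; apply/eqP; ring.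
  rewrite !mulr_sumr -big_split /=; apply: ler_sum => k _.
  have /= := ler_wpM2l h0 (iter_smooth_convex_mean k.+1 mu sigma pos t l a1 a2
    (\sum_(i < k.+1) q i) pp cp l01).
  have /= := ler_wpM2l b0 (iter_smooth_convex_mean k.+1 mu sigma neg t l a1 a2
    (\sum_(i < k.+1) q i) pn cn l01).
  (* The revenue term is affine in the mean, so it contributes an equality despite its negative
     sign. *)
  have -> : upd mu t (l * a1 + (1 - l) * a2) k =
      l * upd mu t a1 k + (1 - l) * upd mu t a2 k.
    by rewrite /upd; case: eqP => // _; ring.
  lra.
move=> s1 s2 s10 s12; have s20 := lt_le_trans s10 s12.
have upd0 s : 0 < s -> forall k, (k < T)%N -> upd sigma t s k != 0.
  by move=> s_gt0 k kT; rewrite /upd; case: (k == t); rewrite gt_eqF// sigma0.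
rewrite !costE; try exact: upd0.
rewrite lee_fin; apply: lerD; first by apply: ler_wpM2l => //; exact: iter_smooth_le_sd.
(* Ordering cost and revenue do not depend on [sigma] and cancel. *)
apply: ler_sum => k _; rewrite !lerD2r; apply: lerD.
  by apply: ler_wpM2l => //; exact: iter_smooth_le_sd.
by apply: ler_wpM2l => //; exact: iter_smooth_le_sd.
Qed.
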